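(* Let $d\ge 2$, $\lambda>0$ and $y_1,y_2,\dots,y_d>0$ be integers. If $2\lambda\mid y_1$, $2\lambda\mid y_2$, $\dots$, and $2\lambda\mid y_d$, then $C_{y_1}\square C_{y_2}\square\cdots\square C_{y_d}$ can be decomposed into $$\frac{1}{2\lambda}\prod_{i=1}^{d}y_i$$ cycles of length $2d\lambda$, each of which has the same number of edges coming from each of the $d$ cycles $C_{y_1},\dots,C_{y_d}$ defining the torus.
   Context: For $b\ge 2$, $C_b$ denotes the cycle of length $b$ (for $b=2$: two vertices joined by two parallel edges). $G\,\square\,H$ is the Cartesian product of graphs: vertices are pairs, and an edge changes exactly one coordinate along an edge of the corresponding factor (for a factor $C_2$, along each of its two parallel edges). An edge of $C_{y_1}\square\cdots\square C_{y_d}$ ''comes from'' the factor $C_{y_k}$ (lies along dimension $k$) if its endpoints differ in the $k$-th coordinate. A graph $G$ is decomposed into subgraphs $H_1,\dots,H_m$ if $G=H_1\cup\cdots\cup H_m$ and the edge sets $E(H_i)$ are pairwise disjoint. *)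

(* Defs.v *)
From mathcomp Require Import all_boot.

Set Implicit Arguments.
Unset Strict Implicit.
Unset Printing Implicit Defensive.

(* Finite multigraphs. Edges are undirected: the order of the pair [ends e] is
   a bookkeeping artefact, which [joins] forgets. *)
Record mgraph := MGraph {
  vertex : finType;
  edge : finType;
  ends : edge -> vertex * vertex }.

Definition joins (G : mgraph) (e : edge G) (u v : vertex G) : Prop :=
  ends e = (u, v) \/ ends e = (v, u).

(* [ordS i] is the cyclic successor of i, so for b = 2 the edges 0 and 1 are
   distinct and parallel. *)
Definition cycle_graph (b : nat) : mgraph :=
  @MGraph 'I_b 'I_b (fun i => (i, ordS i)).

Section CartesianProduct.

Variables (d : nat) (G : 'I_d -> mgraph).

Definition box_vertex : finType := {dffun forall k : 'I_d, vertex (G k)}.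

(* An edge of the product is an edge a of one factor G k together with a vertex
   of each other factor. The latter are stored as a full vertex v of the
   product, normalised by v k = (ends a).1 so that each edge of the product is
   represented exactly once; the edge joins v to v with its k-th coordinate
   replaced by (ends a).2. *)
Definition box_edge : finType :=
  {p : {k : 'I_d & edge (G k)} * box_vertex
     | p.2 (tag p.1) == (ends (tagged p.1)).1}.

Definition box_ends (e : box_edge) : box_vertex * box_vertex :=
  let: (a, v) := val e in
  (v, [ffun j => dfwith v (ends (tagged a)).2 j]).

Definition box : mgraph := MGraph box_ends.

Definition comes_from (e : edge box) (k : 'I_d) : bool :=
  (ends e).1 k != (ends e).2 k.

End CartesianProduct.

Record subgraph (G : mgraph) := Subgraph {
  svertex : {set vertex G};
  sedge : {set edge G};
  sends : forall e, e \in sedge ->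
    ((ends e).1 \in svertex) && ((ends e).2 \in svertex) }.

(* The subgraph H of G is isomorphic to K. *)
Definition is_copy (K G : mgraph) (H : subgraph G) : Prop :=
  exists (f : vertex K -> vertex G) (g : edge K -> edge G),
    [/\ injective f, injective g,
        svertex H = f @: [set: vertex K],
        sedge H = g @: [set: edge K]
      & forall a : edge K, joins (g a) (f (ends a).1) (f (ends a).2)].

Definition is_cycle (n : nat) (G : mgraph) (H : subgraph G) : Prop :=
  is_copy (cycle_graph n) H.

Definition decomposition (G : mgraph) (m : nat) (H : 'I_m -> subgraph G) :
    Prop :=
  [/\ \bigcup_(i < m) svertex (H i) = [set: vertex G],
      \bigcup_(i < m) sedge (H i) = [set: edge G]
    & forall i j : 'I_m, i != j -> [disjoint sedge (H i) & sedge (H j)]].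

Definition torus (d : nat) (y : 'I_d -> nat) : mgraph :=
  box (fun k => cycle_graph (y k)).

(* Main.v *)
Require Import Defs.
From mathcomp Require Import all_boot.
From mathcomp Require Import zify.

(** Write each coordinate of a vertex as x_i = a_i + lambda * b_i with
    0 <= a_i < lambda. As y_i is a multiple of 2 * lambda, the residue a_i and
    the parity of b_i make sense around the cycle C_{y_i}, and moving lambda
    steps in either direction keeps a_i and flips the parity of b_i.

    From a vertex x, walk lambda steps along dimension 0, then lambda steps
    along dimension 1, and so on up to dimension d - 1; this ends at a vertex
    x' ([opposite]) that differs from x by lambda in every coordinate. Walking
    the same dimensions again, in the opposite directions, returns to x: the result is
    a cycle with 2 * lambda edges in every dimension. Everything depends on
    the directions. In dimension i the walk goes forward when b_{i+1} is even
    and backward when it is odd (indices modulo d). All these parities flip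
    between x and x', so the second half of the cycle is exactly the path that
    the same rule attaches to x' ([backward_opposite], [opposite_inv]): the
    cycle is the union of the two half-cycles of x and of x'.

    It remains to choose the starting points. Call x a corner when lambda
    divides the sum of its coordinates; x' is then a corner too. An edge lies
    on the half-cycle of exactly one corner. Indeed, let the edge lie along
    dimension k. Away from k, the coordinates of the corner are those of the
    edge, shifted by lambda where the walk has already passed, so all a_i and
    all parities of b_i with i <> k are known. The corner condition gives a_k.
    The direction of the walk in dimension k depends on b_{k+1}, and
    k + 1 <> k because d >= 2, so it is known; the residue a_k and the
    direction determine x_k. Now all parities are known, hence all directions,
    hence x. This is [half_edge_inj]; existence follows by counting
    ([half_edge_bij_card]), since there are prod y_i / lambda corners, each
    with d * lambda edges on its half-cycle, and d * prod y_i edges in all.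

    The pairs {x, x'} of corners therefore index a decomposition into cycles.
    Each pair has one representative with b_0 even ([base]), which gives
    prod y_i / (2 * lambda) of them ([card_base]). *)

(** * Walking along one cycle *)

Section CycleWalk.

Set Implicit Arguments.
Unset Strict Implicit.

Variable b : nat.
Implicit Types (s : bool) (i : 'I_b).

(** The direction is a Boolean, true for backward walks, so that it can also
    serve as the shift by one in [walk_edge]. *)
Definition walk s i j : 'I_b := iter j (if s then @ord_pred b else @ordS b) i.

Lemma walk_back s i j k :
  k <= j -> walk (~~ s) (walk s i j) k = walk s i (j - k).
Proof.
move=> le_kj; rewrite -{1}(subnKC le_kj) /walk iterD.
elim: k {le_kj} (iter _ _ i) => // k IHk v; rewrite iterSr iterS.
by case: s IHk => IHk; rewrite /= ?ord_predK ?ordSK; apply: IHk.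
Qed.

Lemma val_walk_forward i j : val (walk false i j) = (i + j) %% b.
Proof.
elim: j => [|j IHj] /=; first by rewrite addn0 modn_small.
by rewrite -/(walk false i j) IHj -addn1 modnDml addn1 addnS.
Qed.

(** An edge of the cycle is named by the end from which it goes forward, so a
    backward step is named by its arrival point; whence the shift by s. *)
Lemma walk_edge s i j :
  let e := walk s i (j + s) in
  (e, ordS e) = (walk s i j, walk s i j.+1) \/
  (e, ordS e) = (walk s i j.+1, walk s i j).
Proof.
case: s => /=; last by left; rewrite addn0.
by right; rewrite addn1 /walk /= ord_predK.
Qed.

Lemma walk_mod m s i j : m %| b ->
  if s then walk s i j + j = i %[mod m] else walk s i j = i + j %[mod m].
Proof.
move=> dv_mb; case: s; last by rewrite val_walk_forward modn_dvdm.
have /(congr1 val) := walk_back true i (leqnn j).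
by rewrite subnn /= val_walk_forward => <-; rewrite modn_dvdm.
Qed.

Lemma walk_steps_inj s i j k :
  j < b -> k < b -> walk s i j = walk s i k -> j = k.
Proof.
move=> ltjb ltkb eqw; rewrite -(modn_small ltjb) -(modn_small ltkb); apply/eqP.
have := walk_mod s i j (dvdnn b); have := walk_mod s i k (dvdnn b).
rewrite eqw; case: s {eqw} => E1 E2.
  by rewrite -(eqn_modDl (walk true i k)) E1 E2.
by rewrite -(eqn_modDl i) -E1 E2.
Qed.

Lemma walk_inj s j : injective (fun i => walk s i j).
Proof.
move=> i i' /= eqw.
have := walk_back s i (leqnn j); have := walk_back s i' (leqnn j).
by rewrite eqw subnn /= => -> ->.
Qed.

(** In a fixed direction, the segments of m points that start in one residue
    class modulo m tile the cycle: a point determines its segment and its place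
    in that segment. *)
Lemma walk_residue_inj m s i i' j k : m %| b -> j < m -> k < m ->
  i = i' %[mod m] -> walk s i j = walk s i' k -> j = k /\ i = i'.
Proof.
move=> dv_mb ltjm ltkm eqi eqw.
have eqjk : j = k.
  rewrite -(modn_small ltjm) -(modn_small ltkm); apply/eqP.
  have := walk_mod s i j dv_mb; have := walk_mod s i' k dv_mb.
  rewrite eqw; case: s {eqw} => E1 E2.
    by rewrite -(eqn_modDl (walk true i' k)) E1 E2 eqi.
  by rewrite -(eqn_modDl i) -E2 -modnDml eqi modnDml E1.
by split=> //; apply: (@walk_inj s j); rewrite eqw eqjk.
Qed.

(** Modulo 2 * m, m steps backward amount to m steps forward: residues modulo
    2 * m of half-cycle ends do not depend on the directions chosen. *)
Lemma walk_half_turn m s i :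
  2 * m %| b -> walk s i m = i + m %[mod 2 * m].
Proof.
move=> dv_b; have := @walk_mod (2 * m) s i m dv_b.
case: s => // E; apply/eqP; rewrite -(eqn_modDr m) E -addnA addnn -mul2n.
by rewrite modnDr.
Qed.

End CycleWalk.

(** * Edges of a torus *)

Section TorusEdges.

Set Implicit Arguments.
Unset Strict Implicit.

Variables (d : nat) (y : 'I_d -> nat).

(** The vertex type of [torus y], unfolded so that coordinates are ordinals and
    coerce to natural numbers. *)
Definition torus_vertex := {dffun forall k : 'I_d, 'I_(y k)}.

Implicit Types (k : 'I_d) (u v w : torus_vertex).

(** An edge of the torus is normalised by its base vertex, whose k-th
    coordinate already names the edge of the k-th cycle. So a dimension and a
    base vertex describe it without dependent types. *)
Definition edge_at k v : edge (torus y) :=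
  exist _ (existT (fun k => 'I_(y k)) k (v k), v) (eqxx (v k)).

Lemma edge_at_inj k k' v v' : edge_at k v = edge_at k' v' -> k = k' /\ v = v'.
Proof.
move=> /(congr1 val) eq_kv; have /(congr1 (fun p => tag p.1)) := eq_kv.
by have /(congr1 snd) := eq_kv.
Qed.

Lemma edge_at_surj (e : edge (torus y)) : exists k v, e = edge_at k v.
Proof.
case: e => [[[k c] v]] /= vk; exists k, v; apply: val_inj => /=.
by move/eqP: vk => /= ->.
Qed.

Lemma card_torus_edges : #|edge (torus y)| <= d * \prod_k y k.
Proof.
have -> : d * \prod_k y k = #|{: 'I_d * torus_vertex}|.
  rewrite card_prod card_ord card_dep_ffun foldrE big_map big_enum /=.
  by congr (_ * _); apply: eq_bigr => k _; rewrite card_ord.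
pose kv (e : edge (torus y)) : 'I_d * torus_vertex :=
  (tag (val e).1, (val e).2).
apply: (leq_card kv) => e e'.
have [k [v ->]] := edge_at_surj e; have [k' [v' ->]] := edge_at_surj e'.
by move=> /= [-> ->].
Qed.

Lemma edge_at_joins k v u w :
    (forall i, i != k -> u i = v i) -> (forall i, i != k -> w i = v i) ->
    (v k, ordS (v k)) = (u k, w k) \/ (v k, ordS (v k)) = (w k, u k) ->
  joins (edge_at k v) u w.
Proof.
have ends_k (p q : torus_vertex) : (forall i, i != k -> p i = v i) ->
    (forall i, i != k -> q i = v i) -> (v k, ordS (v k)) = (p k, q k) ->
  ends (edge_at k v) = (p, q).
  move=> p_v q_v [vk Svk]; rewrite /= /box_ends /=; congr (_, _).
    apply/ffunP=> i; have [->|/p_v->] // := eqVneq i k.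
  apply/ffunP=> i; rewrite ffunE; case: dfwithP => [|j] //.
  by rewrite eq_sym => /q_v->.
by move=> u_v w_v [] ends_v; [left | right]; apply: ends_k.
Qed.

Lemma comes_from_edge_at k l v :
  1 < y k -> comes_from (edge_at k v) l = (k == l).
Proof.
move=> y_gt1; rewrite /comes_from /= /box_ends /= ffunE.
case: dfwithP => [|j kj]; last by rewrite eqxx (negPf kj).
rewrite eqxx -val_eqE /=; apply/eqP=> eq_v.
have := ltn_ord (v k); rewrite leq_eqVlt => /orP[/eqP v_last | v_lt].
  move: eq_v; rewrite v_last modnn => v0.
  by move: v_last y_gt1; rewrite v0 => <-.
move: eq_v; rewrite modn_small // => /eqP.
by rewrite -[X in X == _]addn0 -addn1 eqn_add2l.
Qed.

End TorusEdges.

(** * Half-cycles *)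

Lemma odd_divn_mod m i : 0 < m -> odd ((i %% (2 * m)) %/ m) = odd (i %/ m).
Proof.
move=> m_gt0; rewrite {2}(divn_eq i (2 * m)) mulnA divnMDl // oddD muln2.
by rewrite odd_double.
Qed.

Lemma eq_mod_odd_divn m i j :
  0 < m -> i = j %[mod 2 * m] -> odd (i %/ m) = odd (j %/ m).
Proof. by move=> m_gt0 eq_ij; rewrite -odd_divn_mod // eq_ij odd_divn_mod. Qed.

Section HalfCycles.

Set Implicit Arguments.
Unset Strict Implicit.

Variables (d lam : nat) (y : 'I_d -> nat).
Hypotheses (d_ge2 : 2 <= d) (lam_gt0 : 0 < lam) (y_gt0 : forall k, 0 < y k).
Hypothesis dvd_y : forall k, 2 * lam %| y k.

Local Notation V := (torus_vertex y).
Local Notation D := (d * lam).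
Implicit Types (x v : V) (i k : 'I_d) (a : nat).

Let d_gt0 : 0 < d. Proof. exact: ltnW. Qed.
Let k0 : 'I_d := Ordinal d_gt0.

Let dvd_lam k : lam %| y k.
Proof. exact: dvdn_trans (dvdn_mull 2 (dvdnn lam)) (dvd_y k). Qed.

Let lam2_le_y k : 2 * lam <= y k.
Proof. exact: dvdn_leq. Qed.

Let lam_lt_y k : lam < y k.
Proof. by have := lam2_le_y k; lia. Qed.

Lemma ordS_neq i : ordS i != i.
Proof.
rewrite -val_eqE /=; have := ltn_ord i.
rewrite leq_eqVlt => /orP[/eqP i_last | i_lt].
  by rewrite i_last modnn; apply/eqP; lia.
by rewrite modn_small //; apply/eqP; lia.
Qed.

(** The direction along dimension i is read off another coordinate, because an
    edge along dimension i exhibits all coordinates of its ends except the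
    i-th: such an edge then reveals the direction in which it is walked. *)
Definition backward x i : bool := odd (x (ordS i) %/ lam).

(** Number of steps made along dimension i when the half-cycle has made a
    steps in all: none before time i * lam, lam after time i.+1 * lam. *)
Definition steps a i := minn lam (a - i * lam).

Definition half_vertex x a : V :=
  [ffun i => walk (backward x i) (x i) (steps a i)].

Definition opposite x : V := half_vertex x D.

(** The dimension of the step leaving time a. The reduction modulo d makes it
    total; it also gives the right value on the second half of a cycle. *)
Definition active a : 'I_d := Ordinal (ltn_pmod (a %/ lam) d_gt0).

Definition half_edge x a : edge (torus y) :=
  edge_at (active a) ([ffun i => walk (backward x i) (x i)
             (steps a i + (i == active a) && backward x i)] : V).

Lemma steps0 i : steps 0 i = 0.
Proof. by rewrite /steps sub0n minn0. Qed.

Lemma steps_end i : steps D i = lam.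
Proof.
rewrite /steps -mulnBl; apply/minn_idPl.
by rewrite leq_pmull // subn_gt0.
Qed.

Lemma val_active a : a < D -> active a = a %/ lam :> nat.
Proof. by move=> a_lt; rewrite /= modn_small // ltn_divLR. Qed.

Lemma steps_active a : a < D -> steps a (active a) = a %% lam.
Proof.
move=> a_lt; rewrite /steps val_active // {1}(divn_eq a lam) addKn.
by apply/minn_idPr; rewrite ltnW ?ltn_pmod.
Qed.

Lemma steps_activeS a : a < D -> steps a.+1 (active a) = (a %% lam).+1.
Proof.
move=> a_lt; rewrite /steps val_active // {1}(divn_eq a lam) -addnS addKn.
by apply/minn_idPr; rewrite ltn_pmod.
Qed.

(** With c = 0 or 1, this covers both ends of the edge walked at time a. *)
Lemma steps_inactive a c i : a < D -> i != active a -> c <= 1 ->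
  steps (a + c) i = if i < active a then lam else 0.
Proof.
move=> a_lt ne_i c_le1; have {ne_i}: nat_of_ord i != active a by [].
rewrite val_active // => ne_i.
have := divn_eq a lam; have := ltn_pmod a lam_gt0.
move: (a %/ lam) (a %% lam) ne_i => q r ne_i r_lt ->; rewrite /steps.
have [i_lt | i_ge] := ltnP i q.
  by have := leq_mul2r lam i.+1 q; rewrite i_lt orbT mulSn; lia.
have i_gt : q < i by rewrite ltn_neqAle eq_sym ne_i.
by have := leq_mul2r lam q.+1 i; rewrite i_gt orbT mulSn; lia.
Qed.

Lemma half_edge_joins x a : a < D ->
  joins (half_edge x a) (half_vertex x a) (half_vertex x a.+1).
Proof.
move=> a_lt; apply: edge_at_joins => [i ne_i|i ne_i|].
- by rewrite !ffunE (negPf ne_i) addn0.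
- rewrite !ffunE (negPf ne_i) addn0 -{2}[a]addn0 -addn1.
  by rewrite !steps_inactive.
rewrite !ffunE eqxx steps_active // steps_activeS //=.
exact: walk_edge.
Qed.

Lemma opposite_mod x i : opposite x i = x i + lam %[mod 2 * lam].
Proof. by rewrite ffunE steps_end; apply: walk_half_turn. Qed.

Lemma opposite_odd x i : odd (opposite x i %/ lam) = ~~ odd (x i %/ lam).
Proof.
by rewrite (eq_mod_odd_divn lam_gt0 (opposite_mod x i)) divnDr // divnn
  lam_gt0 addn1.
Qed.

Lemma backward_opposite x i : backward (opposite x) i = ~~ backward x i.
Proof. exact: opposite_odd. Qed.

(** The half-cycle of the opposite vertex retraces, in each dimension, the
    steps made by the half-cycle of x. *)
Lemma half_vertex_opposite x a i :
  half_vertex (opposite x) a i = walk (backward x i) (x i) (lam - steps a i).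
Proof.
rewrite ffunE backward_opposite ffunE steps_end walk_back //.
exact: geq_minl.
Qed.

Lemma opposite_inv : involutive opposite.
Proof.
move=> x; apply/ffunP=> i.
by rewrite half_vertex_opposite steps_end subnn.
Qed.

(** The congruence singles out one residue per line of the torus modulo lam,
    so that the segments of length lam along a line do not overlap. *)
Definition corner x := lam %| \sum_i x i.

Lemma sum_mod (u v : 'I_d -> nat) m : (forall i, u i = v i %[mod m]) ->
  \sum_i u i = \sum_i v i %[mod m].
Proof.
move=> uv; rewrite -[LHS]modn_summ -[RHS]modn_summ.
by congr (_ %% _); apply: eq_bigr => i _; apply: uv.
Qed.

Lemma corner_opposite x : corner (opposite x) = corner x.
Proof.
rewrite /corner /dvdn (@sum_mod (fun i => opposite x i) (fun i => x i)) // => i.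
have /(congr1 (modn^~ lam)) := opposite_mod x i.
by rewrite !modn_dvdm ?dvdn_mull // modnDr.
Qed.

(** The heart of the construction: an edge determines the corner whose
    half-cycle contains it. Coordinates other than the active one are
    recovered modulo 2 * lam, which yields first the residue of the active
    coordinate (corner condition), then its direction, then its value, and
    finally the remaining directions. *)
Lemma half_edge_inj x x' a a' : corner x -> corner x' -> a < D -> a' < D ->
  half_edge x a = half_edge x' a' -> x = x' /\ a = a'.
Proof.
move=> x_corner x'_corner a_lt a'_lt /edge_at_inj[eq_active /ffunP eq_v].
set k := active a in eq_active eq_v *.
have inactive_mod i : i != k -> x i = x' i %[mod 2 * lam].
  move=> ne_ik; have := eq_v i; rewrite !ffunE -eq_active (negPf ne_ik) !addn0.
  have ne_ik' : i != active a' by rewrite -eq_active.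
  have := steps_inactive a_lt ne_ik (leq0n 1).
  have := steps_inactive a'_lt ne_ik' (leq0n 1).
  rewrite !addn0 -eq_active => -> ->; case: ifP => _ /= eq_walk; last first.
    by rewrite eq_walk.
  apply/eqP; rewrite -(eqn_modDr lam); apply/eqP.
  have <- := walk_half_turn (backward x i) (x i) (dvd_y i).
  by rewrite eq_walk; apply: walk_half_turn.
have lam_mod i : x i = x' i %[mod 2 * lam] -> x i = x' i %[mod lam].
  by move/(congr1 (modn^~ lam)); rewrite !modn_dvdm ?dvdn_mull.
have active_mod : x k = x' k %[mod lam].
  have : \sum_i x i = \sum_i x' i %[mod lam].
    by move: x_corner x'_corner => /eqP-> /eqP->.
  rewrite (bigD1 k) // [in RHS](bigD1 k) //= => /eqP; rewrite -modnDmr.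
  have -> : \sum_(i | i != k) x i = \sum_(i | i != k) x' i %[mod lam].
    rewrite -[LHS]modn_summ -[RHS]modn_summ.
    congr (_ %% _); apply: eq_bigr => i ne_ik.
    exact/lam_mod/inactive_mod.
  by rewrite modnDmr eqn_modDr => /eqP.
have eq_backward i : x (ordS i) = x' (ordS i) %[mod 2 * lam] ->
  backward x i = backward x' i by apply: eq_mod_odd_divn.
have [eq_r eq_xk] : a %% lam = a' %% lam /\ x k = x' k.
  have := eq_v k; rewrite !ffunE -eq_active eqxx /= steps_active //.
  rewrite eq_active steps_active // -eq_active.
  (* Both walks go in the same direction: ordS k is an inactive coordinate. *)
  rewrite (eq_backward k); last exact/inactive_mod/ordS_neq.
  (* The common shift naming a backward edge is one last step, and cancels. *)
  set s := backward x' k; rewrite addnC [in RHS]addnC.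
  rewrite /walk !iterD -!/(walk _ _ _) => /walk_inj.
  by apply: (walk_residue_inj (dvd_lam k)); rewrite ?ltn_pmod.
have eq_s i : backward x i = backward x' i.
  apply: eq_backward; have [->|] := eqVneq (ordS i) k; first by rewrite eq_xk.
  exact: inactive_mod.
split.
  apply/ffunP=> i; have [-> //|ne_ik] := eqVneq i k.
  have := eq_v i; rewrite !ffunE eq_s -eq_active (negPf ne_ik) !addn0.
  have ne_ik' : i != active a' by rewrite -eq_active.
  have := steps_inactive a_lt ne_ik (leq0n 1).
  have := steps_inactive a'_lt ne_ik' (leq0n 1).
  by rewrite !addn0 -eq_active => -> -> /walk_inj.
rewrite (divn_eq a lam) (divn_eq a' lam) eq_r -!val_active //.
by congr (_ * _ + _); rewrite -/k eq_active.
Qed.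

(** * The cycles of the decomposition *)

Definition cycle_vertex x (a : 'I_(2 * d * lam)) : vertex (torus y) :=
  if a < D then half_vertex x a else half_vertex (opposite x) (a - D).

Definition cycle_edge x (a : 'I_(2 * d * lam)) : edge (torus y) :=
  if a < D then half_edge x a else half_edge (opposite x) (a - D).

Let cycle_length : 2 * d * lam = D + D.
Proof. by rewrite -mulnA mul2n addnn. Qed.

Let ltn_cycle_length (a : 'I_(2 * d * lam)) : a < D + D.
Proof. by rewrite -cycle_length. Qed.

Lemma cycle_edge_joins x (a : 'I_(2 * d * lam)) :
  joins (cycle_edge x a) (cycle_vertex x a) (cycle_vertex x (ordS a)).
Proof.
have D_gt0 : 0 < D by rewrite muln_gt0 d_gt0.
have vertex0 v : half_vertex v 0 = v.
  by apply/ffunP=> i; rewrite ffunE steps0.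
have a_lt2 := ltn_cycle_length a.
have next_val m : m < D + D ->
    m.+1 %% (2 * d * lam) = if m.+1 < D + D then m.+1 else 0.
  rewrite cycle_length => m_lt; have [|m_last] := ltnP m.+1 (D + D).
    exact: modn_small.
  have -> : m.+1 = D + D by lia.
  by rewrite modnn.
rewrite /cycle_edge /cycle_vertex /= next_val //.
have [a_lt | a_ge] := ltnP a D.
  have -> : a.+1 < D + D by lia.
  have := half_edge_joins x a_lt; case: ltnP => // a_last.
  have -> : a.+1 = D by lia.
  by rewrite subnn vertex0.
have aD_lt : a - D < D by lia.
have := half_edge_joins (opposite x) aD_lt; rewrite -subSn //.
have [a1_lt | a1_ge] := ltnP a.+1 (D + D).
  by rewrite ltnNge leqW.
have -> : a.+1 = D + D by lia.
by rewrite D_gt0 addnK vertex0 -/(opposite _) opposite_inv.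
Qed.

(** Vertices of one cycle are told apart by the vector of steps made along
    each dimension. The i-th entry is at most lam, hence less than y i, so it
    can be read off the i-th coordinate. *)
Lemma cycle_vertex_inj x : injective (cycle_vertex x).
Proof.
pose pos (a : nat) i := if a < D then steps a i else lam - steps (a - D) i.
have vertexE (a : 'I_(2 * d * lam)) i :
      cycle_vertex x a i = walk (backward x i) (x i) (pos a i).
  rewrite /cycle_vertex /pos; case: ifP => _; last exact: half_vertex_opposite.
  by rewrite ffunE.
have pos_lt a i : pos a i < y i.
  apply: leq_ltn_trans (lam_lt_y i); rewrite /pos.
  by case: ifP => _; rewrite ?leq_subr // geq_minl.
have lt_dmax : d.-1 < d by rewrite prednK.
pose kmax : 'I_d := Ordinal lt_dmax.
(* The first dimension is completed before the last one begins, and undone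
   before the last one is: the two halves differ in one of them. *)
have pos_halves (a a' : 'I_(2 * d * lam)) :
    a < D -> D <= a' -> (forall i, pos a i = pos a' i) -> False.
  have a'_lt := ltn_cycle_length a'; move=> a_lt a'_ge eq_pos.
  have := eq_pos k0; have := eq_pos kmax.
  rewrite /pos a_lt ltnNge a'_ge /= /steps /= mul0n !subn0.
  have : d.-1 * lam + lam = D by rewrite -mulSnr prednK.
  have : 2 * lam <= D by rewrite leq_mul2r d_ge2 orbT.
  lia.
(* The dimension active at time a has strictly more steps at any later time. *)
have pos_lt_half a b : a < b -> b < D -> (forall i, steps a i = steps b i) ->
    False.
  move=> ltab b_lt /(_ (active a)); have a_lt := ltn_trans ltab b_lt.
  rewrite steps_active // /steps val_active //.
  by have := divn_eq a lam; have := ltn_pmod a lam_gt0; lia.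
move=> a b /ffunP eq_v.
have eq_pos i : pos a i = pos b i.
  apply: (@walk_steps_inj _ (backward x i) (x i)); rewrite ?pos_lt //.
  rewrite -!vertexE; exact: eq_v.
have a_lt2 := ltn_cycle_length a; have b_lt2 := ltn_cycle_length b.
apply: val_inj => /=; have [a_lt | a_ge] := ltnP a D.
  have [b_lt | b_ge] := ltnP b D; last by case: (pos_halves a b).
  have {}eq_pos i : steps a i = steps b i.
    by have := eq_pos i; rewrite /pos a_lt b_lt.
  by have [/pos_lt_half[]|/pos_lt_half[]|] := ltngtP a b.
have [b_lt | b_ge] := ltnP b D; first by case: (pos_halves b a).
have {}eq_pos i : steps (a - D) i = steps (b - D) i.
  have := eq_pos i; rewrite /pos !ltnNge a_ge b_ge /= /steps; lia.
have [/pos_lt_half[]|/pos_lt_half[]|] := ltngtP (a - D) (b - D) => //; lia.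
Qed.

(** One corner of each pair of opposite corners: coordinate 0 moves by lam
    between them, so exactly one has an even quotient there. *)
Definition base x := corner x && ~~ odd (x k0 %/ lam).

Lemma cycle_edge_inj x x' (a a' : 'I_(2 * d * lam)) :
    base x -> base x' ->
  cycle_edge x a = cycle_edge x' a' -> x = x' /\ a = a'.
Proof.
move=> /andP[x_corner x_even] /andP[x'_corner x'_even].
have a_lt2 := ltn_cycle_length a; have a'_lt2 := ltn_cycle_length a'.
rewrite /cycle_edge; case: ltnP => a_lt; case: ltnP => a'_lt.
- by move/half_edge_inj=> [] // -> /val_inj.
- have a'D_lt : a' - D < D by lia.
  move/half_edge_inj; rewrite corner_opposite => -[] // eq_x _.
  by rewrite eq_x opposite_odd x'_even in x_even.
- have aD_lt : a - D < D by lia.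
  move/half_edge_inj; rewrite corner_opposite => -[] // eq_x _.
  by rewrite -eq_x opposite_odd x_even in x'_even.
have [aD_lt a'D_lt] : a - D < D /\ a' - D < D by lia.
move/half_edge_inj; rewrite !corner_opposite => -[] //.
move=> /(can_inj opposite_inv)-> eq_a; split=> //; apply: val_inj => /=; lia.
Qed.

(** Every vertex is reached from a corner by fewer than lam forward steps
    along dimension 0. *)
Lemma card_corner_ge : \prod_k y k <= #|[set x | corner x]| * lam.
Proof.
pose r (w : V) := (\sum_i w i) %% lam.
pose to_corner (w : V) : V :=
  [ffun i => if i == k0 then walk true (w i) (r w) else w i].
have to_cornerP w : corner (to_corner w).
  rewrite /corner /dvdn (bigD1 k0) //= ffunE eqxx.
  rewrite (eq_bigr (fun i => nat_of_ord (w i))); last first.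
    by move=> i /negPf ne_i; rewrite ffunE ne_i.
  rewrite -[X in _ == X](mod0n lam) -(eqn_modDr (r w)) addnAC.
  rewrite -modnDml (walk_mod true) // modnDml.
  by rewrite add0n /r modn_mod [in X in _ == X](bigD1 k0).
pose pair_of w := (to_corner w, Ordinal (ltn_pmod (\sum_i w i) lam_gt0)).
have pair_inj : injective pair_of.
  move=> w w' [/ffunP eq_x eq_r]; apply/ffunP=> i; have := eq_x i.
  rewrite !ffunE /r eq_r; case: eqP => // _; exact: walk_inj.
have -> : \prod_k y k = #|[set: V]|.
  rewrite cardsT card_dep_ffun foldrE big_map big_enum /=.
  by apply: eq_bigr => k _; rewrite card_ord.
have -> : #|[set x | corner x]| * lam =
    #|setX [set x | corner x] [set: 'I_lam]|.
  by rewrite cardsX cardsT card_ord.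
rewrite -(card_imset [set: V] pair_inj).
apply/subset_leq_card/subsetP=> _ /imsetP[w _ ->].
by rewrite !inE to_cornerP.
Qed.

(** Injectivity bounds the number of corners from above, [card_corner_ge]
    bounds it from below by the same value; equality makes the injection of
    corners and times into edges surjective. *)
Lemma half_edge_bij_card :
  #|[set x | corner x]| * lam = \prod_k y k /\
  forall e, exists x a, [/\ corner x, a < D & e = half_edge x a].
Proof.
set C := [set x | corner x]; set N := \prod_k y k.
pose h (p : V * 'I_D) := half_edge p.1 p.2.
pose E := h @: setX C [set: 'I_D].
have card_E : #|E| = #|C| * D.
  rewrite card_in_imset ?cardsX ?cardsT ?card_ord // => -[x a] [x' a'].
  rewrite !inE !andbT => x_corner x'_corner /half_edge_inj[] //= -> /val_inj->.
  by [].
have le_E : #|E| <= #|edge (torus y)| by apply: max_card.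
have le_e : #|edge (torus y)| <= d * N := card_torus_edges y.
have le_N : d * N <= #|C| * D.
  by rewrite mulnCA leq_mul2l card_corner_ge orbT.
split.
  apply/eqP; rewrite eqn_leq card_corner_ge andbT -(leq_pmul2l d_gt0) mulnCA.
  by rewrite -card_E (leq_trans le_E).
move=> e; have : e \in E.
  have -> : E = [set: edge (torus y)].
    apply/eqP; rewrite eqEcard subsetT cardsT card_E.
    exact: leq_trans le_e le_N.
  by rewrite inE.
by case/imsetP=> -[x a] /setXP[]; rewrite inE => x_corner _ ->; exists x, a.
Qed.

Lemma card_base : #|[set x | base x]| * (2 * lam) = \prod_k y k.
Proof.
have [<- _] := half_edge_bij_card; rewrite mulnA; congr (_ * _).
set B := [set x | base x]; set C := [set x | corner x].
have opp_inj := can_inj opposite_inv.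
have B_sub : B \subset C by apply/subsetP=> x; rewrite !inE => /andP[].
rewrite -(cardsID B C) (setIidPr B_sub) muln2 -addnn; congr (_ + _).
rewrite -(card_imset B opp_inj); congr #|pred_of_set _|.
apply/setP=> x; rewrite -{1}[x]opposite_inv (mem_imset _ _ opp_inj) !inE.
by rewrite /base corner_opposite opposite_odd; case: corner; case: odd.
Qed.

Lemma cycle_edge_surj e :
  exists x (a : 'I_(2 * d * lam)), base x /\ e = cycle_edge x a.
Proof.
have [_ /(_ e)[x [a [x_corner a_lt ->]]]] := half_edge_bij_card.
case x_odd : (odd (x k0 %/ lam)).
  have a_lt2 : D + a < 2 * d * lam by rewrite cycle_length ltn_add2l.
  exists (opposite x), (Ordinal a_lt2).
  rewrite /base corner_opposite opposite_odd x_odd x_corner /cycle_edge /=.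
  by rewrite ltnNge leq_addr addKn opposite_inv.
have a_lt2 : a < 2 * d * lam by rewrite cycle_length ltn_addr.
by exists x, (Ordinal a_lt2); rewrite /base x_odd x_corner /cycle_edge /= a_lt.
Qed.

Lemma comes_from_cycle_edge x (a : 'I_(2 * d * lam)) k :
  comes_from (cycle_edge x a) k = ((a %/ lam) %% d == k).
Proof.
have comes v b : comes_from (half_edge v b) k = ((b %/ lam) %% d == k).
  by rewrite comes_from_edge_at // (leq_trans _ (lam2_le_y _)) ?leq_pmulr.
rewrite /cycle_edge; case: ltnP => [_ | a_ge]; first exact: comes.
by rewrite comes -{2}(subnK a_ge) addnC divnMDl // modnDl.
Qed.

(** Moving the active dimension from k to l, within the same half and at the
    same offset, injects one set into the other. *)
Lemma card_active_le (k l : 'I_d) :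
  #|[set a : 'I_(2 * d * lam) | (a %/ lam) %% d == k]| <=
  #|[set a : 'I_(2 * d * lam) | (a %/ lam) %% d == l]|.
Proof.
pose shift (a : nat) := (a %/ lam %/ d * d + l) * lam + a %% lam.
have shift_div a : shift a %/ lam = a %/ lam %/ d * d + l.
  by rewrite /shift divnMDl // (divn_small (ltn_pmod a lam_gt0)) addn0.
have shift_lt (a : 'I_(2 * d * lam)) : shift a < 2 * d * lam.
  rewrite -ltn_divLR // shift_div -ltn_divLR // divnMDl //.
  by rewrite (divn_small (ltn_ord l)) addn0 !ltn_divLR.
pose f (a : 'I_(2 * d * lam)) := Ordinal (shift_lt a).
have f_inj : {in [set a : 'I_(2 * d * lam) | (a %/ lam) %% d == k] &,
    injective f}.
  move=> a b; rewrite !inE => /eqP a_k /eqP b_k /(congr1 val) /= eq_ab.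
  apply: val_inj; rewrite /= (divn_eq a lam) (divn_eq b lam).
  rewrite (divn_eq (a %/ lam) d) (divn_eq (b %/ lam) d) a_k b_k.
  have := congr1 (modn^~ lam) eq_ab; rewrite /shift !modnMDl !modn_mod => ->.
  have := congr1 (divn^~ lam) eq_ab; rewrite !shift_div => /addIn/eqP.
  by rewrite eqn_pmul2r // => /eqP->.
rewrite -(card_in_imset f_inj).
apply/subset_leq_card/subsetP=> _ /imsetP[a _ ->].
by rewrite inE /= shift_div modnMDl modn_small.
Qed.

End HalfCycles.

(** * Subgraphs traced by closed walks *)

Section ClosedWalks.

Set Implicit Arguments.
Unset Strict Implicit.

Variables (G : mgraph) (n : nat).
Variables (f : 'I_n -> vertex G) (g : 'I_n -> edge G).
Hypothesis gP : forall a, joins (g a) (f a) (f (ordS a)).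

Lemma closed_walk_sends e : e \in g @: [set: 'I_n] ->
  ((ends e).1 \in f @: [set: 'I_n]) && ((ends e).2 \in f @: [set: 'I_n]).
Proof.
case/imsetP=> a _ ->.
by have [->|->] := gP a; rewrite /= !imset_f ?inE.
Qed.

Definition closed_walk_subgraph : subgraph G := Subgraph closed_walk_sends.

Lemma closed_walk_is_cycle :
  injective f -> injective g -> is_cycle n closed_walk_subgraph.
Proof. by move=> f_inj g_inj; exists f, g; split. Qed.

End ClosedWalks.

(** * The decomposition *)

Theorem theorem2 (d lambda : nat) (y : 'I_d -> nat)
    (d_ge2 : 2 <= d) (lambda_gt0 : 0 < lambda) (y_gt0 : forall k, 0 < y k)
    (dvd_y : forall k, 2 * lambda %| y k) :
  exists H : 'I_((\prod_(k < d) y k) %/ (2 * lambda)) -> subgraph (torus y),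
    [/\ decomposition H,
        forall i, is_cycle (2 * d * lambda) (H i)
      & forall i (k l : 'I_d),
          #|[set e in sedge (H i) | comes_from e k]| =
          #|[set e in sedge (H i) | comes_from e l]|].
Proof.
rewrite -(card_base d_ge2 lambda_gt0 dvd_y) mulnK ?muln_gt0 //.
set B := [set x | _].
have base_val (i : 'I_#|B|) : base lambda d_ge2 (enum_val i).
  by have := enum_valP i; rewrite inE.
pose H (i : 'I_#|B|) :=
  closed_walk_subgraph (cycle_edge_joins d_ge2 lambda_gt0 dvd_y (enum_val i)).
have edge_inj (i : 'I_#|B|) :
      injective (cycle_edge (lam := lambda) d_ge2 (enum_val i)).
  move=> a a' /(cycle_edge_inj lambda_gt0 dvd_y (base_val i) (base_val i)).
  by case.
have edge_cover e : exists i, e \in sedge (H i).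
  have [x [a [x_base ->]]] := cycle_edge_surj d_ge2 lambda_gt0 dvd_y e.
  have x_B : x \in B by rewrite inE.
  exists (enum_rank_in x_B x); rewrite /= enum_rankK_in //.
  by apply: imset_f; rewrite inE.
exists H; split=> [|i|i k l].
- split.
  + apply/setP=> v; rewrite [RHS]inE; apply/bigcupP.
    pose k0 : 'I_d := Ordinal (ltnW d_ge2).
    have [i e_i] := edge_cover (edge_at k0 (v : torus_vertex y)).
    by have /andP[v_i _] := sends e_i; exists i.
  + apply/setP=> e; rewrite [RHS]inE; apply/bigcupP.
    by have [i e_i] := edge_cover e; exists i.
  + move=> i j ne_ij; apply/pred0P=> e /=; apply/negP=> /andP[].
    case/imsetP=> a _ -> /imsetP[b _].
    move/(cycle_edge_inj lambda_gt0 dvd_y (base_val i) (base_val j)).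
    by case=> /enum_val_inj eq_ij; rewrite eq_ij eqxx in ne_ij.
- apply: closed_walk_is_cycle; first exact: cycle_vertex_inj.
  exact: edge_inj.
have edges_from k' : [set e in sedge (H i) | comes_from e k'] =
    cycle_edge d_ge2 (enum_val i) @:
      [set a : 'I_(2 * d * lambda) | (a %/ lambda) %% d == k'].
  apply/setP=> e; rewrite inE; apply/andP/imsetP=> [[/imsetP[a _ ->]] | [a]].
    by rewrite comes_from_cycle_edge // => a_k'; exists a; rewrite ?inE.
  by rewrite inE => a_k' ->; rewrite imset_f ?inE // comes_from_cycle_edge.
rewrite !edges_from !card_imset //.
by apply/eqP; rewrite eqn_leq !card_active_le.
Qed.
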